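(* The following problem $\mathrm{LeftIdentities}$ can be computed in polynomial time. Input: transformations $a_1,\dots,a_k\in T_n$. Problem: enumerate (output the list of all) left identities of $\langle a_1,\dots,a_k\rangle$.
   Context: $T_n$ is the full transformation semigroup on $[n]=\{1,\dots,n\}$: all maps $[n]\to[n]$, acting on the right, under composition (so $q\cdot st=(qs)t$). $\langle a_1,\dots,a_k\rangle$ is the subsemigroup of $T_n$ generated by $a_1,\dots,a_k$ ($k,n\ge 1$). In the input and output each transformation is given by its table of values; $k,n$ are part of the input. An element $\ell$ of a semigroup $S$ is a left identity if $\ell s=s$ for all $s\in S$. *)

(* Defs.v *)
From HB Require Import structures.
From Stdlib Require Import BinNums.
From mathcomp Require Import all_boot all_order all_algebra.

Set Implicit Arguments.
Unset Strict Implicit.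
Unset Printing Implicit Defensive.

(* [None] is the blank; [inl] is an input/output symbol, [inr] a symbol that is
   private to the machine. *)
Definition cell (Sigma work : Type) := option (Sigma + work).

(* A two-way infinite tape: the cells strictly to the left of the head, nearest
   first, and the cells from the head on.  Cells beyond both lists are blank. *)
Definition tape (Sigma work : Type) : Type :=
  seq (cell Sigma work) * seq (cell Sigma work).

Inductive move := MoveLeft | Stay | MoveRight.

Record machine (Sigma : finType) := Machine {
  work : finType;
  state : finType;
  tapes : nat;               (* the machine has [tapes.+1] tapes *)
  start : state;
  halted : pred state;
  trans : state -> {ffun 'I_tapes.+1 -> cell Sigma work} ->
          state * ('I_tapes.+1 -> cell Sigma work * move)
}.

Section Tape.
Variables Sigma work : Type.
Implicit Type t : tape Sigma work.

Definition scan t : cell Sigma work := head None t.2.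

Definition act t (a : cell Sigma work * move) : tape Sigma work :=
  let: (l, r) := (t.1, a.1 :: behead t.2) in
  match a.2 with
  | MoveLeft => (behead l, head None l :: r)
  | Stay => (l, r)
  | MoveRight => (a.1 :: l, behead r)
  end.

Definition blank_tape : tape Sigma work := ([::], [::]).

(* The head is on the first symbol of [w]. *)
Definition tape_of_word (w : seq Sigma) : tape Sigma work :=
  ([::], [seq Some (inl s) | s <- w]).

Fixpoint read_word (r : seq (cell Sigma work)) : seq Sigma :=
  if r is Some (inl s) :: r' then s :: read_word r' else [::].

End Tape.

Section Run.
Variables (Sigma : finType) (M : machine Sigma).

Definition config : Type :=
  state M * {ffun 'I_(tapes M).+1 -> tape Sigma (work M)}.

(* The input is on the first tape; all other tapes are blank. *)
Definition init (w : seq Sigma) : config :=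
  (start M,
   [ffun i => if i == ord0 then tape_of_word _ w else blank_tape _ _]).

Definition step (c : config) : config :=
  if halted c.1 then c else
  let: (q, a) := trans c.1 [ffun i => scan (c.2 i)] in
  (q, [ffun i => act (c.2 i) (a i)]).

(* The output is on the last tape: the word that starts under the head and
   extends to the first cell that does not carry a symbol of [Sigma]. *)
Definition output (c : config) : seq Sigma := read_word (c.2 ord_max).2.

Definition computes_within (T : nat) (w w' : seq Sigma) : Prop :=
  exists t, [/\ t <= T, halted (iter t step (init w)).1
              & output (iter t step (init w)) = w'].

End Run.

(* A search problem: for each instance [x], a solution is any [y] with
   [R x y]. *)
Definition polytime_computable (Sigma : finType)
    (I : Type) (O : I -> Type)
    (encI : I -> seq Sigma) (encO : forall x : I, O x -> seq Sigma)
    (R : forall x : I, O x -> Prop) : Prop :=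
  exists (M : machine Sigma) (p : {poly nat}),
    forall x : I, exists2 y : O x, R x y &
      computes_within M (p.[size (encI x)])%R (encI x) (encO x y).

Definition transf (n : nat) : Type := {ffun 'I_n -> 'I_n}.

HB.instance Definition _ n := Finite.copy (transf n) {ffun 'I_n -> 'I_n}.

(* Maps act on the right, so the left factor is applied first. *)
Definition transf_mul n (s t : transf n) : transf n := [ffun q => t (s q)].

Lemma transf_mulA n : associative (@transf_mul n).
Proof. by move=> s t u; apply/ffunP => q; rewrite !ffunE. Qed.

HB.instance Definition _ n := isSemigroup.Build (transf n) (@transf_mulA n).

Inductive subsemigroup_generated (G : semigroupType) (A : seq G) : G -> Prop :=
| SG_gen a of a \in A : subsemigroup_generated A a
| SG_mul s t of subsemigroup_generated A s & subsemigroup_generated A t :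
    subsemigroup_generated A (s * t)%g.

Definition left_identity (G : semigroupType) (S : G -> Prop) (l : G) : Prop :=
  S l /\ forall s, S s -> (l * s)%g = s.

Inductive symbol := Bit of bool | Comma | Semicolon.

Definition symbol_code (s : symbol) : option (option bool) :=
  match s with
  | Bit b => Some (Some b)
  | Comma => Some None
  | Semicolon => None
  end.

Definition symbol_decode (o : option (option bool)) : symbol :=
  match o with
  | Some (Some b) => Bit b
  | Some None => Comma
  | None => Semicolon
  end.

Lemma symbol_codeK : cancel symbol_code symbol_decode.
Proof. by case. Qed.

HB.instance Definition _ := Finite.copy symbol (can_type symbol_codeK).

(* Binary numerals, least significant digit first. *)
Fixpoint bits_of_pos (p : positive) : seq bool :=
  match p with
  | xI p' => true :: bits_of_pos p'
  | xO p' => false :: bits_of_pos p'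
  | xH => [:: true]
  end.

Definition bits_of_nat (m : nat) : seq bool :=
  if bin_of_nat m is Npos p then bits_of_pos p else [::].

(* The ordinal [i] stands for the point [i.+1] of {1, ..., n}. *)
Definition encode_point n (i : 'I_n) : seq symbol :=
  rcons [seq Bit b | b <- bits_of_nat i.+1] Comma.

Definition encode_transf n (s : transf n) : seq symbol :=
  rcons (flatten [seq encode_point (s q) | q <- enum 'I_n]) Semicolon.

Definition encode_transfs n (l : seq (transf n)) : seq symbol :=
  flatten [seq encode_transf s | s <- l].

Record instance := Instance {
  degree : nat;
  degree_gt0 : 0 < degree;
  ngens : nat;
  ngens_gt0 : 0 < ngens;
  gens : ngens.-tuple (transf degree)
}.

Definition encode_instance (x : instance) : seq symbol :=
  encode_transfs (gens x).

Definition encode_solution (x : instance) (l : seq (transf (degree x))) :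
    seq symbol :=
  encode_transfs l.

Definition LeftIdentities (x : instance) (l : seq (transf (degree x))) : Prop :=
  uniq l /\
  forall s : transf (degree x),
    s \in l <-> left_identity (subsemigroup_generated (gens x)) s.

(* Main.v *)
(** The left identities of [<a_1, ..., a_k>] are few.  Call [e] a retraction of
    [a] if every [e q] is some [a p] with [a (a p) = a q].  A left identity [s]
    ending in the generator [a] satisfies [s a = a], hence is a retraction of
    [a].  Conversely, if [a] has a retraction then [a] permutes its image with
    some finite order, so the retraction is unique and is a power of [a].  The
    left identities are thus the retractions [e] of generators such that
    [e a_j = a_j] for all [j]: at most [k] elements, found by searching the
    tables.

    For the polynomial bound, all numbers are kept in unary on tapes and never
    exceed the input length plus one, and every loop counts down a number.  In
    such a language any program, whatever it computes, runs in polynomial time,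
    so no cost analysis of the particular algorithm is needed. *)

Require Import Defs.
From Stdlib Require Import FunctionalExtensionality.
From HB Require Import structures.
From mathcomp Require Import all_boot ssralg poly zify.

Set Implicit Arguments.
Unset Strict Implicit.
Unset Printing Implicit Defensive.

(** * While programs over stacks *)

Notation word := (seq symbol).

(** Each stack will live on a tape of its own. Tests see only the top symbol, or [None] on an empty
    stack, so a finite control can decide them. *)
Inductive com :=
| Push of nat & symbol
| Pop of nat
| Seq of com & com
| If of nat & pred (option symbol) & com & com
| While of nat & pred (option symbol) & com.

Definition store := nat -> word.

Definition upd (s : store) r x : store := fun r' => if r' == r then x else s r'.

(** The number is the exact count of machine steps in the simulation below: a push moves the head
    and then writes, a test takes one step. *)
Inductive exec : com -> store -> store -> nat -> Prop :=
| ExecPush s r a : exec (Push r a) s (upd s r (a :: s r)) 2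
| ExecPop s r : exec (Pop r) s (upd s r (behead (s r))) 1
| ExecSeq c1 c2 s1 s2 s3 n m of exec c1 s1 s2 n & exec c2 s2 s3 m :
    exec (Seq c1 c2) s1 s3 (n + m)
| ExecIf r (P : pred (option symbol)) c1 c2 s s' n of
    exec (if P (ohead (s r)) then c1 else c2) s s' n :
    exec (If r P c1 c2) s s' n.+1
| ExecWhileF r (P : pred (option symbol)) c s of ~~ P (ohead (s r)) :
    exec (While r P c) s s 1
| ExecWhileT r (P : pred (option symbol)) c s1 s2 s3 n m of P (ohead (s1 r))
    & exec c s1 s2 n
    & exec (While r P c) s2 s3 m : exec (While r P c) s1 s3 (n + m).+1.

Fixpoint regs_below R c :=
  match c with
  | Push r _ | Pop r => r < R
  | Seq c1 c2 => regs_below R c1 && regs_below R c2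
  | If r _ c1 c2 => [&& r < R, regs_below R c1 & regs_below R c2]
  | While r _ c => (r < R) && regs_below R c
  end.

Lemma regs_belowW R R' c : R <= R' -> regs_below R c -> regs_below R' c.
Proof.
move=> le; elim: c => /=.
- by move=> r _ /leq_trans; apply.
- by move=> r /leq_trans; apply.
- by move=> c1 IH1 c2 IH2 /andP[/IH1-> /IH2->].
- by move=> r _ c1 IH1 c2 IH2 /and3P[/leq_trans-> // /IH1-> /IH2->].
- by move=> r _ c IH /andP[/leq_trans-> // /IH->].
Qed.

Lemma regs_below_exists c : exists R, regs_below R c.
Proof.
elim: c => /=.
- by move=> r _; exists r.+1.
- by move=> r; exists r.+1.
- move=> c1 [R1 h1] c2 [R2 h2]; exists (R1 + R2).
  by rewrite (regs_belowW _ h1) ?leq_addr // (regs_belowW _ h2) ?leq_addl.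
- move=> r _ c1 [R1 h1] c2 [R2 h2]; exists (r.+1 + R1 + R2).
  rewrite (regs_belowW _ h1) ?(regs_belowW _ h2) //; lia.
- move=> r _ c [R h]; exists (r.+1 + R).
  rewrite (regs_belowW _ h) //; lia.
Qed.

(** * Simulation by multitape machines *)

(** The [bool] of a push tells whether the head has moved; the extra [None] of [If] and [While] is
    the state that makes the test. *)
Fixpoint control (c : com) : finType :=
  match c with
  | Push _ _ => bool
  | Pop _ => unit
  | Seq c1 c2 => (control c1 + control c2)%type
  | If _ _ c1 c2 => option (control c1 + control c2)%type
  | While _ _ c => option (control c)
  end.

Fixpoint entry c : control c :=
  match c return control c with
  | Push _ _ => false
  | Pop _ => tt
  | Seq c1 _ => inl (entry c1)
  | If _ _ _ _ => None
  | While _ _ _ => None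
  end.

Section Simulation.
Variables (T R : nat) (phi : nat -> 'I_T.+1).

Local Notation cel := (cell symbol void).
Local Notation scans := {ffun 'I_T.+1 -> cel}.
Local Notation tps := {ffun 'I_T.+1 -> tape symbol void}.
Local Notation actions := ('I_T.+1 -> cel * move).

Definition rest (sc : scans) : actions := fun i => (sc i, Stay).

Definition act_on (sc : scans) r (a : cel * move) : actions :=
  fun i => if i == phi r then a else rest sc i.

Definition top (x : cel) : option symbol :=
  if x is Some (inl a) then Some a else None.

(* The state [None] is the exit of the subprogram. *)
Fixpoint control_step c : control c -> scans -> option (control c) * actions :=
  match c return control c -> scans -> option (control c) * actions with
  | Push r a => fun q sc =>
      if q then (None, act_on sc r (Some (inl a), Stay))
      else (Some true, act_on sc r (sc (phi r), MoveLeft))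
  | Pop r => fun _ sc =>
      (None, if top (sc (phi r)) is Some _ then act_on sc r (None, MoveRight)
             else rest sc)
  | Seq c1 c2 => fun q sc =>
      match q with
      | inl q1 => let: (q', a) := control_step q1 sc in
          (Some (if q' is Some q1' then inl q1' else inr (entry c2)), a)
      | inr q2 => let: (q', a) := control_step q2 sc in (omap inr q', a)
      end
  | If r P c1 c2 => fun q sc =>
      match q with
      | None => (Some (Some (if P (top (sc (phi r))) then inl (entry c1)
                             else inr (entry c2))), rest sc)
      | Some (inl q1) => let: (q', a) := control_step q1 sc in
          (omap (fun q1' => Some (inl q1')) q', a)
      | Some (inr q2) => let: (q', a) := control_step q2 sc in
          (omap (fun q2' => Some (inr q2')) q', a)
      end
  | While r P c => fun q sc =>
      match q with
      | None => (if P (top (sc (phi r))) then Some (Some (entry c)) else None,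
                 rest sc)
      | Some q1 => let: (q', a) := control_step q1 sc in (Some q', a)
      end
  end.

Definition scan_all (t : tps) : scans := [ffun i => scan (t i)].
Definition act_all (t : tps) (a : actions) : tps := [ffun i => act (t i) (a i)].

Inductive reach c : control c -> tps -> nat -> tps -> Prop :=
| Reach1 q t a of control_step q (scan_all t) = (None, a) :
    reach q t 1 (act_all t a)
| ReachS q q' t a n t' of control_step q (scan_all t) = (Some q', a)
    & reach q' (act_all t a) n t' : reach q t n.+1 t'.

Lemma reach_seq c1 c2 (q : control c1) t n t' m t'' :
  reach q t n t' -> reach (entry c2) t' m t'' ->
  reach (c := Seq c1 c2) (inl q) t (n + m) t''.
Proof.
have inrP (q2 : control c2) t1 k t2 : reach q2 t1 k t2 ->
    reach (c := Seq c1 c2) (inr q2) t1 k t2.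
  elim=> {q2 t1 k t2} [q2 t1 a e | q2 q2' t1 a k t2 e _ IH].
    by apply: Reach1; rewrite /= e.
  by apply: ReachS IH; rewrite /= e.
elim=> {q t n t'} [q t a e /inrP h | q q' t a n t' e _ IH /IH h].
  by apply: ReachS h; rewrite /= e.
by apply: ReachS h; rewrite /= e.
Qed.

(** A test step rewrites the scanned cells, which can turn an implicit blank into an explicit one;
    hence the branch starts from [t0]. *)
Lemma reach_if r P c1 c2 (t : tps) n t' (t0 := act_all t (rest (scan_all t))) :
  (if P (top (scan (t (phi r)))) then reach (entry c1) t0 n t'
   else reach (entry c2) t0 n t') ->
  reach (c := If r P c1 c2) None t n.+1 t'.
Proof.
have lP (q : control c1) t1 k t2 :
    reach q t1 k t2 -> reach (c := If r P c1 c2) (Some (inl q)) t1 k t2.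
  elim=> {q t1 k t2} [q t1 a e | q q' t1 a k t2 e _ IH].
    by apply: Reach1; rewrite /= e.
  by apply: ReachS IH; rewrite /= e.
have rP (q : control c2) t1 k t2 :
    reach q t1 k t2 -> reach (c := If r P c1 c2) (Some (inr q)) t1 k t2.
  elim=> {q t1 k t2} [q t1 a e | q q' t1 a k t2 e _ IH].
    by apply: Reach1; rewrite /= e.
  by apply: ReachS IH; rewrite /= e.
by case E: (P _); [move/lP|move/rP] => h; apply: ReachS h; rewrite /= ffunE E.
Qed.

(** The exit [None] of the body, read as a state of the loop, is its test state, so leaving the body
    leads back to the test. *)
Lemma reach_while r P c (q : control c) t n t' m t'' :
  reach q t n t' -> reach (c := While r P c) None t' m t'' ->
  reach (c := While r P c) (Some q) t (n + m) t''.
Proof.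
elim=> {q t n t'} [q t a e h | q q' t a n t' e _ IH /IH h].
  by apply: ReachS h; rewrite /= e.
by apply: ReachS h; rewrite /= e.
Qed.

(* Whatever lies to the left of the head is garbage: a push overwrites it. *)
Definition contents (t : tape symbol void) : word := read_word t.2.

Lemma ohead_contents t : ohead (contents t) = top (scan t).
Proof. by case: t => l [|[[a|[]]|] r]. Qed.

Lemma contents_stay t : contents (act t (scan t, Stay)) = contents t.
Proof. by case: t => l [|[[a|[]]|] r]. Qed.

Lemma contents_push t a :
  contents (act (act t (scan t, MoveLeft)) (Some (inl a), Stay)) = a :: contents t.
Proof. by case: t => [[|y l]] [|[[b|[]]|] r]. Qed.

Lemma contents_pop t x : top (scan t) = Some x ->
  contents (act t (None, MoveRight)) = behead (contents t).
Proof. by case: t => l [|[[b|[]]|] r]. Qed.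

Lemma contents_top0 t : top (scan t) = None -> contents t = [::].
Proof. by case: t => l [|[[b|[]]|] r]. Qed.

Hypothesis phi_inj : forall r r', r < R -> r' < R -> phi r = phi r' -> r = r'.

Definition agree (s : store) (t : tps) :=
  forall r, r < R -> contents (t (phi r)) = s r.

Lemma agree_rest s t : agree s t -> agree s (act_all t (rest (scan_all t))).
Proof. by move=> st r ltr; rewrite !ffunE /rest ffunE contents_stay st. Qed.

Lemma act_all_on t r a r' : r < R -> r' < R ->
  contents (act_all t (act_on (scan_all t) r a) (phi r')) =
  if r' == r then contents (act (t (phi r)) a) else contents (t (phi r')).
Proof.
move=> ltr ltr'; rewrite !ffunE /act_on; case: (altP (r' =P r)) => [-> | ne].
  by rewrite eqxx.
case: eqP => [/phi_inj e|_]; first by rewrite e ?eqxx in ne.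
by rewrite /rest ffunE contents_stay.
Qed.

(** Only the cells from the head on are controlled, so the induction ranges over all tapes that
    agree with the store. *)
Lemma exec_reach c s s' n : exec c s s' n -> regs_below R c ->
  forall t, agree s t -> exists2 t', reach (entry c) t n t' & agree s' t'.
Proof.
elim=> {c s s' n} /=.
- move=> s r a ltr t sat.
  eexists.
    apply: (@ReachS (Push r a) false true); first by [].
    by apply: (@Reach1 (Push r a) true).
  move=> r' ltr'; rewrite act_all_on // /upd.
  case: eqP => [_ | ne]; last first.
    by rewrite act_all_on // (introF eqP ne); apply: sat.
  by rewrite /act_all /scan_all /act_on !ffunE eqxx contents_push sat.
- move=> s r ltr t sat.
  eexists; first exact: Reach1.
  have -> : scan_all t (phi r) = scan (t (phi r)) by rewrite ffunE.
  move=> r' ltr'; rewrite /upd.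
  case E: (top _) => [x|].
    rewrite act_all_on //; case: eqP => _; last exact: sat.
    by rewrite (contents_pop E) sat.
  (* On an empty stack the head stays: moving right could uncover cells about which [agree] says
     nothing. *)
  rewrite (agree_rest sat) //; case: eqP => // ->.
  by rewrite -(sat r ltr) (contents_top0 E).
- move=> c1 c2 s1 s2 s3 n m _ IH1 _ IH2 /andP[b1 b2] t1.
  move=> /(IH1 b1)[t2 r1 /(IH2 b2)[t3 r2 st3]].
  by exists t3 => //; apply: reach_seq r1 r2.
- move=> r P c1 c2 s s' n _ IH /and3P[ltr b1 b2] t sat.
  have /IH/(_ _ (agree_rest sat))[t' rt st'] :
    regs_below R (if P (ohead (s r)) then c1 else c2) by case: ifP.
  exists t' => //; apply: reach_if.
  by rewrite -ohead_contents sat //; case: ifP rt.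
- move=> r P c s nP /andP[ltr b] t sat.
  eexists; first apply: Reach1.
    by rewrite /= ffunE -ohead_contents sat // (negPf nP).
  exact: agree_rest.
- move=> r P c s1 s2 s3 n m yP _ IH1 _ IH2 /andP[ltr b] t1 st1.
  have [t2 r1 st2] := IH1 b _ (agree_rest st1).
  have [t3 r2 st3] := IH2 (introT andP (conj ltr b)) _ st2.
  exists t3 => //; apply: ReachS (reach_while r1 r2).
  by rewrite /= ffunE -ohead_contents st1 // yP.
Qed.
End Simulation.

Definition com_machine T (phi : nat -> 'I_T.+1) c : machine symbol :=
  @Machine symbol void (option (control c)) T (Some (entry c)) (fun q => q == None)
    (fun q sc => if q is Some q' then control_step phi q' sc else (None, rest sc)).

Lemma reach_iter T (phi : nat -> 'I_T.+1) c (q : control c) t n t' :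
  reach phi q t n t' ->
  iter n (@step _ (com_machine phi c)) (Some q, t) = (None, t').
Proof.
elim=> {q t n t'} [q t a e | q q' t a n t' e _ IH].
  by rewrite /= /step /= -/(scan_all t) e.
rewrite iterSr {2}/step /= -/(scan_all t) e; exact: IH.
Qed.

Definition input_store (w : word) : store := fun r => if r == 0 then w else [::].

Lemma com_machine_computes c (p : {poly nat}) (out : word -> word) :
  (forall w, exists s n,
     [/\ exec c (input_store w) s n, n <= p.[size w]%R & s 1 = out w]) ->
  exists M : machine symbol, forall w, computes_within M p.[size w]%R w (out w).
Proof.
(* The bound is raised by two so that the input and output stacks 0 and 1 lie below it even if [c]
   does not mention them. *)
move=> hc; have [R0 /(@regs_belowW _ R0.+2)] := regs_below_exists c.
set R := R0.+2 => /(_ (leqW (leqnSn _))) cR.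
(* The machine model puts the input on the first tape and the output on the last; the other stacks
   take the tapes between. *)
pose phi r : 'I_R.+1 :=
  if r == 0 then ord0 else if r == 1 then ord_max else inord r.-1.
have phi_inj r r' : r < R -> r' < R -> phi r = phi r' -> r = r'.
  move=> lr lr' /(congr1 val); rewrite /phi.
  by case: r lr => [|[|r]] lr; case: r' lr' => [|[|r']] lr' //=;
    rewrite ?inordK //; lia.
exists (com_machine phi c) => w.
have [s [n [ex le out_s]]] := hc w.
have [|t' rt st'] := exec_reach phi_inj ex cR (t := (init (com_machine phi c) w).2).
  move=> r lr; rewrite ffunE /input_store /phi.
  case: r lr => [|[|r]] lr //=.
    by rewrite /contents /=; elim: w {hc ex le out_s} => //= a w ->.
  by rewrite -val_eqE /= inordK //; lia.
exists n; rewrite (reach_iter rt); split=> //.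
by rewrite -out_s -(st' 1).
Qed.

(** * Unary arithmetic with stacks *)

Definition runs c s s' b := exists2 n, exec c s s' n & n <= b.

Lemma runs_le c s s' b b' : runs c s s' b -> b <= b' -> runs c s s' b'.
Proof. by move=> [n ex le] le'; exists n => //; apply: leq_trans le'. Qed.

Lemma runs_seq c1 c2 s1 s2 s3 b1 b2 :
  runs c1 s1 s2 b1 -> runs c2 s2 s3 b2 -> runs (Seq c1 c2) s1 s3 (b1 + b2).
Proof.
move=> [n1 ex1 le1] [n2 ex2 le2].
by exists (n1 + n2); [apply: ExecSeq ex1 ex2 | apply: leq_add].
Qed.

Lemma runs_push r a s : runs (Push r a) s (upd s r (a :: s r)) 2.
Proof. by exists 2 => //; apply: ExecPush. Qed.

Lemma runs_pop r s : runs (Pop r) s (upd s r (behead (s r))) 1.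
Proof. by exists 1 => //; apply: ExecPop. Qed.

Lemma runs_if r (P : pred (option symbol)) c1 c2 s s' b :
  runs (if P (ohead (s r)) then c1 else c2) s s' b ->
  runs (If r P c1 c2) s s' b.+1.
Proof. by move=> [n ex le]; exists n.+1 => //; apply: ExecIf. Qed.

Lemma runs_whileF r (P : pred (option symbol)) c s :
  ~~ P (ohead (s r)) -> runs (While r P c) s s 1.
Proof. by exists 1 => //; apply: ExecWhileF. Qed.

Lemma runs_whileT r (P : pred (option symbol)) c s1 s2 s3 b1 b2 :
  P (ohead (s1 r)) -> runs c s1 s2 b1 -> runs (While r P c) s2 s3 b2 ->
  runs (While r P c) s1 s3 (b1 + b2).+1.
Proof.
move=> yP [n1 ex1 le1] [n2 ex2 le2].
by exists (n1 + n2).+1; [apply: ExecWhileT ex1 ex2 | rewrite ltnS leq_add].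
Qed.

Lemma runs_eq c s s' s'' b : runs c s s' b -> s' =1 s'' -> runs c s s'' b.
Proof. by move=> h /functional_extensionality <-. Qed.

Notation nonempty := (@isSome symbol).
Notation mark := (Bit true).

Ltac upd_tac :=
  try (move=> ?); rewrite /upd;
  repeat (case: eqP => ? //=); subst => //=; try congruence; try lia.

Definition clear r := While r nonempty (Pop r).

Lemma clear_runs r s : runs (clear r) s (upd s r [::]) (2 * size (s r)).+1.
Proof.
move: {2}(s r) (erefl (s r)) => l; elim: l s => [|a l IH] s sr.
  apply: (@runs_le _ _ _ 1) => //; apply: runs_eq.
    by apply: runs_whileF; rewrite sr.
  by upd_tac.
rewrite sr /=; apply: runs_le (runs_whileT _ (runs_pop _ _) (runs_eq (IH _ _) _)) _.
- by rewrite sr.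
- by rewrite /upd eqxx sr.
- by upd_tac.
by rewrite /upd eqxx sr /=; lia.
Qed.

Definition transfer r r' := While r nonempty (Seq (Pop r) (Push r' mark)).

Lemma transfer_runs r r' s v v' : r != r' -> s r = nseq v mark ->
  s r' = nseq v' mark ->
  runs (transfer r r') s (upd (upd s r [::]) r' (nseq (v + v') mark)) (4 * v).+1.
Proof.
move=> /eqP ne; elim: v v' s => [|v IH] v' s sr sr'.
  apply: (@runs_le _ _ _ 1) => //; apply: runs_eq.
    by apply: runs_whileF; rewrite sr.
  by upd_tac.
apply: runs_le (runs_whileT _ (runs_seq (runs_pop _ _) (runs_push _ _ _))
  (runs_eq (IH v'.+1 _ _ _) _)) _.
- by rewrite sr.
- by rewrite sr; upd_tac.
- by upd_tac.
- by rewrite addnS; upd_tac.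
- by upd_tac.
Qed.

(** Reading a stack destroys it, so [r] is poured into both [r'] and the scratch stack [t], and [t]
    is poured back. *)
Definition copy r r' t :=
  Seq (While r nonempty (Seq (Pop r) (Seq (Push r' mark) (Push t mark))))
      (transfer t r).

Lemma copy_runs r r' t s v : r != r' -> r != t -> r' != t ->
  s r = nseq v mark -> s r' = [::] -> s t = [::] ->
  runs (copy r r' t) s (upd s r' (nseq v mark)) (10 * v + 2).
Proof.
move=> ne1 ne2 ne3 sr sr' st.
suff loop k k' s0 : s0 r = nseq k mark -> s0 r' = nseq k' mark ->
  s0 t = nseq k' mark ->
    runs (While r nonempty (Seq (Pop r) (Seq (Push r' mark) (Push t mark)))) s0
      (upd (upd (upd s0 r [::]) r' (nseq (k + k') mark)) t (nseq (k + k') mark))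
      (6 * k).+1.
  apply: runs_le (runs_seq (loop v 0 s sr sr' st) 
    (runs_eq (transfer_runs (v := v) (v' := 0) _ _ _) _)) _.
  - by rewrite eq_sym.
  - by rewrite addn0; upd_tac.
  - by move/eqP: ne1; move/eqP: ne2; upd_tac.
  - by rewrite !addn0; upd_tac.
  by lia.
elim: k k' s0 => [|k IH] k' s0 s0r s0r' s0t.
  by apply: runs_eq; [apply: runs_whileF; rewrite s0r | upd_tac].
move/eqP: ne1; move/eqP: ne2; move/eqP: ne3 => ne1 ne2 ne3.
apply: runs_le (runs_whileT _ (runs_seq (runs_pop _ _) (runs_seq (runs_push _ _ _)
  (runs_push _ _ _))) (runs_eq (IH k'.+1 _ _ _ _) _)) _.
- by rewrite s0r.
- by rewrite s0r; upd_tac.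
- by upd_tac.
- by upd_tac.
- by rewrite addnS; upd_tac.
by lia.
Qed.

Definition subtract r r' := While r' nonempty (Seq (Pop r') (Pop r)).

(** Popping an empty stack changes nothing, which makes the subtraction truncated. *)
Lemma subtract_runs r r' s v v' : r != r' -> s r = nseq v mark ->
  s r' = nseq v' mark ->
  runs (subtract r r') s (upd (upd s r' [::]) r (nseq (v - v') mark)) (3 * v').+1.
Proof.
move=> /eqP ne; elim: v' v s => [|v' IH] v s sr sr'.
  by rewrite subn0; apply: runs_eq; [apply: runs_whileF; rewrite sr' | upd_tac].
apply: runs_le (runs_whileT _ (runs_seq (runs_pop _ _) (runs_pop _ _))
  (runs_eq (IH v.-1 _ _ _) _)) _.
- by rewrite sr'.
- by rewrite sr'; upd_tac; rewrite sr; case: (v).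
- by upd_tac; rewrite sr'.
- by rewrite -subn1 -subnDA; upd_tac.
by lia.
Qed.

(** A push names a fixed symbol, hence one branch for each of the four; the last [Pop] has no
    effect, as the stack is empty there. *)
Definition move_top r r' :=
  let mv a := Seq (Pop r) (Push r' a) in
  If r (fun x => x == Some (Bit true)) (mv (Bit true))
 (If r (fun x => x == Some (Bit false)) (mv (Bit false))
 (If r (fun x => x == Some Comma) (mv Comma)
 (If r (fun x => x == Some Semicolon) (mv Semicolon) (Pop r)))).

Lemma move_top_runs r r' s : r != r' ->
  runs (move_top r r') s
    (if s r is a :: l then upd (upd s r l) r' (a :: s r') else s) 7.
Proof.
move=> /eqP ne.
have mv a l : s r = a :: l ->
    runs (Seq (Pop r) (Push r' a)) s (upd (upd s r l) r' (a :: s r')) 3.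
  move=> sr; apply: runs_eq (runs_seq (runs_pop _ _) (runs_push _ _ _)) _.
  by rewrite sr /=; upd_tac.
case sr: (s r) => [|a l].
  do 4 (apply: runs_if; rewrite sr /=).
  apply: (@runs_le _ _ _ 1) => //; apply: runs_eq (runs_pop _ _) _.
  by rewrite sr; upd_tac.
have {mv}mv := mv _ _ sr.
case: a sr mv => [[]||] sr mv;
  do ?[by apply: runs_le mv _ | apply: runs_if; rewrite sr /=].
Qed.

(* Stack 0 is the input, 1 the output, 2 holds the part of the input that has
   been scanned, and [j.+3] holds the number in register [j] in unary.
   Register [j] is numbered from the bottom of the environment [e], so that
   pushing a value leaves the registers in use where they are. *)
Fixpoint reg (e : seq nat) j :=
  if e is v :: e' then if j == size e' then v else reg e' j else 0.

Definition layout (w aux out : word) (e : seq nat) : store := fun r =>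
  match r with
  | 0 => w | 1 => out | 2 => aux | j.+3 => nseq (reg e j) mark
  end.

Lemma reg_ge e j : size e <= j -> reg e j = 0.
Proof. by elim: e j => //= v e IH j lt; rewrite gtn_eqF // IH // ltnW. Qed.

(** A register holding 0 is an empty stack, so registers with value 0 appear and disappear at no
    cost. *)
Lemma layout0 w x o e : layout w x o (0 :: e) = layout w x o e.
Proof.
apply: functional_extensionality => -[|[|[|j]]] //=.
by case: eqP => // ->; rewrite reg_ge.
Qed.

Ltac layout_tac :=
  let j := fresh "j" in
  move=> [|[|[|j]]] //; rewrite /upd /= ?eqSS //;
  repeat (case: eqP => ? //=); subst; rewrite ?reg_ge //=; try congruence; try lia.

Lemma clear_top w x o e v :
  runs (clear (size e).+3) (layout w x o (v :: e)) (layout w x o e) (2 * v).+1.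
Proof.
have := clear_runs (size e).+3 (layout w x o (v :: e));
  rewrite /= eqxx size_nseq => h.
by apply: runs_eq h _; layout_tac.
Qed.

(** Removes a bound variable from under the result of the body that used it. *)
Definition drop_second d := Seq (clear d.+3) (transfer d.+4 d.+3).

Lemma eqnSn n : (n == n.+1) = false. Proof. by rewrite ltn_eqF. Qed.
Lemma eqSnn n : (n.+1 == n) = false. Proof. by rewrite gtn_eqF. Qed.

Lemma drop_second_runs w x o e v v' :
  runs (drop_second (size e)) (layout w x o (v' :: v :: e)) (layout w x o (v' :: e))
    (2 * v + 4 * v' + 2).
Proof.
have h := clear_runs (size e).+3 (layout w x o (v' :: v :: e)).
apply: runs_le (runs_seq h (runs_eq (transfer_runs (v := v') (v' := 0) _ _ _) _)) _.
- by rewrite eqSnn.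
- by rewrite /upd /= eqSnn eqxx.
- by rewrite /upd eqxx.
- by rewrite addn0; layout_tac.
by rewrite /= eqnSn eqxx size_nseq; lia.
Qed.

(** The register counts down while symbols pass to stack 2, so that the symbol at the given position
    comes to the top of the input. *)
Definition seek d := While d.+3 nonempty (Seq (Pop d.+3) (move_top 0 2)).

Lemma seek_runs w x o e v :
  runs (seek (size e)) (layout w x o (v :: e))
    (layout (drop v w) (catrev (take v w) x) o e)
    (9 * v).+1.
Proof.
elim: v w x => [|v IH] w x.
  rewrite drop0 take0 /= -[in X in runs _ _ X]layout0.
  by apply: (@runs_le _ _ _ 1) => //; apply: runs_whileF; rewrite /= eqxx.
have -> : drop v.+1 w = drop v (behead w) by case: w.
have -> : catrev (take v.+1 w) x =
    catrev (take v (behead w)) (if w is a :: _ then a :: x else x) by case: w.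
apply: runs_le (runs_whileT _ (runs_seq (runs_pop _ _)
  (runs_eq (move_top_runs _ _) _))
  (IH (behead w) (if w is a :: _ then a :: x else x))) _.
- by rewrite /= eqxx.
- by [].
- by case: w => [|a w]; layout_tac.
by lia.
Qed.

Definition rewind := While 2 nonempty (move_top 2 0).

Lemma rewind_runs w x o e :
  runs rewind (layout w x o e) (layout (catrev x w) [::] o e) (8 * size x).+1.
Proof.
elim: x w => [|a x IH] w.
  by apply: (@runs_le _ _ _ 1) => //; apply: runs_whileF.
apply: runs_le (runs_whileT _ (runs_eq (move_top_runs _ _) _) (IH (a :: w))) _
  => //.
- by layout_tac.
by rewrite /=; lia.
Qed.

Definition measure d :=
  Seq (Push d.+3 mark)
 (Seq (While 0 nonempty (Seq (move_top 0 2) (Push d.+3 mark))) rewind).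

Lemma measure_runs w o e :
  runs (measure (size e)) (layout w [::] o e) (layout w [::] o ((size w).+1 :: e))
    (18 * size w + 4).
Proof.
have loop w0 x v :
    runs (While 0 nonempty (Seq (move_top 0 2) (Push (size e).+3 mark)))
      (layout w0 x o (v :: e)) (layout [::] (catrev w0 x) o ((size w0 + v) :: e))
      (10 * size w0).+1.
  elim: w0 x v => [|a w0 IH] x v.
    by apply: (@runs_le _ _ _ 1) => //; apply: runs_whileF.
  rewrite addSnnS.
  apply: runs_le (runs_whileT _ (runs_seq (move_top_runs _ _)
    (runs_eq (runs_push _ _ _) _)) (IH (a :: x) v.+1)) _ => //.
  - by layout_tac.
  by rewrite /=; lia.
apply: runs_le (runs_seq (runs_eq (runs_push _ _ _) _) (runs_seq (loop w [::] 1)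
  (runs_eq (rewind_runs _ _ _ _) _))) _.
- by layout_tac.
- by rewrite !catrevE !cats0 revK addn1.
by rewrite catrevE cats0 size_rev; lia.
Qed.

(** * Bounded arithmetic terms *)

(* De Bruijn indices; [Let] binds one variable and the body of [Fold] two, the
   accumulator and, below it, the counter.  [Len] is one more than the length of
   the input, a bound for all values. *)
Inductive term :=
| Var of nat
| One
| Len
| Sym of symbol & term
| Sub of term & term
| Ite of term & term & term
| Let of term & term
| Fold of term & term.

Section Eval.
Variable w : word.

Fixpoint eval (e : seq nat) t : nat :=
  match t with
  | Var i => nth 0 e i
  | One => 1
  | Len => (size w).+1
  | Sym a t => ohead (drop (eval e t) w) == Some a
  | Sub t u => eval e t - eval e u
  | Ite t u v => if eval e t != 0 then eval e u else eval e v
  | Let t u => eval (eval e t :: e) u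
  | Fold t u => foldr (fun y acc => eval (acc :: y :: e) u) 0 (iota 0 (eval e t))
  end.

Definition bounded := all (fun v => v <= (size w).+1).

Lemma foldr_bounded (f : nat -> nat -> nat) n b :
  (forall y acc, y < n -> acc <= b -> f y acc <= b) ->
  foldr f 0 (iota 0 n) <= b.
Proof.
move=> hf; have : all (fun y => y < n) (iota 0 n).
  by apply/allP => y; rewrite mem_iota.
by elim: (iota 0 n) => //= y l IH /andP[ly /IH]; apply: hf.
Qed.

(** Tests yield 0 or 1, subtraction never grows, and the counter of a [Fold] stays below the value
    it starts from. *)
Lemma eval_bounded t e : bounded e -> eval e t <= (size w).+1.
Proof.
elim: t e => //= [i|a t IH|t IHt u IHu|t IHt u IHu v IHv|t IHt u IHu|t IHt u IHu]
  e be.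
- case: (ltnP i (size e)) => [lt|ge]; last by rewrite nth_default.
  exact: (all_nthP 0 be).
- by case: eqP.
- by apply: leq_trans (leq_subr _ _) (IHt _ be).
- by case: ifP => _; [apply: IHu | apply: IHv].
- by apply: IHu; rewrite /= IHt.
apply: foldr_bounded => y acc ly lacc; apply: IHu; rewrite /= lacc be andbT.
exact: leq_trans (ltnW ly) (IHt _ be).
Qed.
End Eval.

(** * Polynomial cost bounds *)

Definition polynomial (f : nat -> nat) :=
  exists p : {poly nat}, forall n, f n = p.[n]%R.

Lemma polynomial_const k : polynomial (fun _ => k).
Proof. by exists (k%:P)%R => n; rewrite hornerC. Qed.

Lemma polynomial_id : polynomial id.
Proof. by exists 'X%R => n; rewrite hornerX. Qed.

Lemma polynomial_add f g : polynomial f -> polynomial g ->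
  polynomial (fun n => f n + g n).
Proof. by move=> [p hp] [q hq]; exists (p + q)%R => n; rewrite hornerD hp hq. Qed.

Lemma polynomial_mul f g : polynomial f -> polynomial g ->
  polynomial (fun n => f n * g n).
Proof. by move=> [p hp] [q hq]; exists (p * q)%R => n; rewrite hornerM hp hq. Qed.

Lemma polynomial_succ f : polynomial f -> polynomial (fun n => (f n).+1).
Proof.
move=> [p hp]; exists (p + 1%:P)%R => n; rewrite hornerD hornerC -hp.
exact: esym (addn1 _).
Qed.

Ltac poly_tac := repeat first
  [ exact: polynomial_const | exact: polynomial_id | assumption
  | apply: polynomial_succ | apply: polynomial_add | apply: polynomial_mul ].

(** * Compilation of terms *)

Lemma reg_bounded w E j : bounded w E -> reg E j <= (size w).+1.
Proof. by elim: E => //= v E IH /andP[hv hE]; case: ifP => _ //; apply: IH. Qed.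

Lemma map_reg_bounded w E m : bounded w E -> bounded w (map (reg E) m).
Proof.
by move=> bE; rewrite /bounded all_map; apply/allP => j _; apply: reg_bounded.
Qed.

Lemma map_reg_push E m v : all (fun j => j < size E) m ->
  map (reg (v :: E)) m = map (reg E) m.
Proof. by elim: m => //= j m IH /andP[lt /IH->]; rewrite ltn_eqF. Qed.

Lemma below_push d m : all (fun j => j < d) m -> all (fun j => j < d.+1) m.
Proof. by apply: sub_all => j /ltnW. Qed.

(** [m] gives the register of each variable of [t]. It is kept apart from [E] because temporaries,
    such as the first operand of a subtraction, occupy registers without binding a variable. The
    result goes to register [d], the next free one. *)
Definition computes_value d m t c f := forall w o E, size E = d -> bounded w E ->
  runs c (layout w [::] o E) (layout w [::] o (eval w (map (reg E) m) t :: E))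
    (f (size w)).

Lemma term_computable t d m : all (fun j => j < d) m ->
  exists c f, polynomial f /\ computes_value d m t c f.
Proof.
rewrite /computes_value.
elim: t d m =>
  [i|||a t IHt|t IHt u IHu|t IHt u IHu v IHv|t IHt u IHu|t IHt u IHu] d m hm.
- case: (ltnP i (size m)) => [lt|ge]; last first.
    (* An unbound variable has value 0, which the free register already holds; the pop changes
       nothing. *)
    exists (Pop d.+3), (fun _ => 1); split; first by poly_tac.
    move=> w o E szE bE; rewrite /= nth_default ?size_map // -{1}layout0.
    apply: runs_eq (runs_pop _ _) _; subst d.
    by rewrite /= eqxx; layout_tac.
  have ltd := all_nthP 0 hm i lt.
  exists (copy (nth 0 m i).+3 d.+3 d.+4), (fun n => 10 * n.+1 + 2); split;
    first by poly_tac.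
  move=> w o E szE bE; rewrite /= (nth_map 0) //; subst d.
  apply: runs_le (runs_eq (copy_runs (v := reg E (nth 0 m i)) _ _ _ _ _ _) _) _.
  + by rewrite !eqSS ltn_eqF.
  + by rewrite !eqSS ltn_eqF // ltnS ltnW.
  + by rewrite eqnSn.
  + by [].
  + by rewrite /= reg_ge.
  + by rewrite /= reg_ge.
  + by layout_tac.
  + by rewrite leq_add2r leq_mul2l reg_bounded.
- exists (Push d.+3 mark), (fun _ => 2); split; first by poly_tac.
  move=> w o E szE bE; apply: runs_eq (runs_push _ _ _) _; subst d.
  by rewrite /= reg_ge //; layout_tac.
- exists (measure d), (fun n => 18 * n + 4); split; first by poly_tac.
  by move=> w o E <- bE; apply: measure_runs.
- have [c [f [hf hc]]] := IHt d m hm.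
  (* [seek] empties register [d], which then receives the answer of the test. *)
  exists (Seq c (Seq (seek d)
    (Seq (If 0 (fun x => x == Some a) (Push d.+3 mark) (Pop d.+3)) rewind))).
  exists (fun n => f n + ((9 * n.+1).+1 + (3 + (8 * n).+1))); split;
    first by poly_tac.
  move=> w o E szE bE; have := hc w o E szE bE; subst d.
  set v := eval _ _ t => h.
  have le : v <= (size w).+1 by apply/eval_bounded/map_reg_bounded.
  have h1 := seek_runs w [::] o E v; rewrite catrevE cats0 in h1.
  have := rewind_runs (drop v w) (rev (take v w)) o
    ((ohead (drop v w) == Some a : nat) :: E).
  rewrite catrevE revK cat_take_drop => h3.
  have h2 :
    runs (If 0 (fun x => x == Some a) (Push (size E).+3 mark) (Pop (size E).+3))
      (layout (drop v w) (rev (take v w)) o E)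
      (layout (drop v w) (rev (take v w)) o
        ((ohead (drop v w) == Some a : nat) :: E)) 3.
    apply: runs_if; rewrite /=; case: eqP => _ /=.
      by apply: runs_eq (runs_push _ _ _) _; rewrite /= reg_ge //; layout_tac.
    rewrite layout0; apply: (@runs_le _ _ _ 1) => //;
      apply: runs_eq (runs_pop _ _) _.
    by rewrite /= reg_ge //; layout_tac.
  apply: runs_le (runs_seq h (runs_seq h1 (runs_seq h2 h3))) _.
  rewrite size_rev size_take; move: le; case: ifP; lia.
- have [c1 [f1 [hf1 hc1]]] := IHt d m hm.
  have [c2 [f2 [hf2 hc2]]] := IHu d.+1 m (below_push hm).
  exists (Seq c1 (Seq c2 (subtract d.+3 d.+4))).
  exists (fun n => f1 n + (f2 n + (3 * n.+1).+1)).
  split; first by poly_tac.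
  move=> w o E szE bE; have h1 := hc1 w o E szE bE; subst d.
  set e := map (reg E) m in h1 *.
  have be : bounded w e by apply: map_reg_bounded.
  have /(_ w o (eval w e t :: E)) := hc2;
    rewrite /= eval_bounded // map_reg_push //.
  move=> /(_ erefl bE) h2.
  apply: runs_le (runs_seq h1 (runs_seq h2
    (runs_eq (subtract_runs (v := eval w e t) (v' := eval w e u) _ _ _) _))) _ => /=.
  + by rewrite eqnSn.
  + by rewrite eqnSn eqxx.
  + by rewrite eqxx.
  + by layout_tac.
  + by rewrite !leq_add2l ltnS leq_mul2l eval_bounded.
- have [c1 [f1 [hf1 hc1]]] := IHt d m hm.
  have [c2 [f2 [hf2 hc2]]] := IHu d m hm.
  have [c3 [f3 [hf3 hc3]]] := IHv d m hm.
  exists (Seq c1 (If d.+3 nonempty (Seq (clear d.+3) c2) c3)).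
  exists (fun n => f1 n + ((2 * n.+1).+1 + f2 n + f3 n).+1); split;
    first by poly_tac.
  move=> w o E szE bE; have h1 := hc1 w o E szE bE.
  have h2 := hc2 w o E szE bE; have h3 := hc3 w o E szE bE; subst d.
  set e := map (reg E) m in h1 h2 h3 *.
  have := eval_bounded t (map_reg_bounded m bE); rewrite -/e => le.
  apply: runs_seq h1 _; apply: runs_if; rewrite /= eqxx.
  case: (eval w e t) le => [|k] le /=.
    by rewrite layout0; apply: runs_le h3 _; rewrite leq_addl.
  by apply: runs_le (runs_seq (clear_top _ _ _ _ _) h2) _; lia.
- have [c1 [f1 [hf1 hc1]]] := IHt d m hm.
  have [|c2 [f2 [hf2 hc2]]] := IHu d.+1 (d :: m);
    first by rewrite /= leqnn below_push.
  exists (Seq c1 (Seq c2 (drop_second d))).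
  exists (fun n => f1 n + (f2 n + (2 * n.+1 + 4 * n.+1 + 2))).
  split; first by poly_tac.
  move=> w o E szE bE; have h1 := hc1 w o E szE bE; subst d.
  set e := map (reg E) m in h1 *.
  have be : bounded w e by apply: map_reg_bounded.
  have le := eval_bounded t be.
  have /(_ w o (eval w e t :: E)) := hc2; rewrite /= le map_reg_push // eqxx -/e.
  move=> /(_ erefl bE) h2.
  apply: runs_le (runs_seq h1 (runs_seq h2 (drop_second_runs _ _ _ _ _ _))) _ => /=.
  have : eval w (eval w e t :: e) u <= (size w).+1.
    by apply: eval_bounded; rewrite /= le.
  by move: le; lia.
- have [c1 [f1 [hf1 hc1]]] := IHt d m hm.
  have [|c2 [f2 [hf2 hc2]]] := IHu d.+2 [:: d.+1, d & m].
    by rewrite /= leqnn leqnSn; do 2!apply: below_push.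
  (* Register [d] is the counter, popped before each round, and [d.+1] the accumulator, initially
     empty and thus 0. Each round leaves the new accumulator in [d.+2], from where it replaces the
     old one. *)
  exists (Seq c1 (Seq
    (While d.+3 nonempty (Seq (Pop d.+3) (Seq c2 (drop_second d.+1))))
    (drop_second d))).
  exists (fun n => f1 n + ((n.+1 * (1 + (f2 n + (2 * n.+1 + 4 * n.+1 + 2))).+1).+1
     + (2 * 0 + 4 * n.+1 + 2))).
  split; first by poly_tac.
  move=> w o E szE bE; have h1 := hc1 w o E szE bE; subst d.
  set e := map (reg E) m in h1 *.
  have be : bounded w e by apply: map_reg_bounded.
  have le := eval_bounded t be.
  pose b := 1 + (f2 (size w) + (2 * (size w).+1 + 4 * (size w).+1 + 2)).
  set step := fun y acc => eval w [:: acc, y & e] u.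
  have eqm acc y : [seq reg [:: acc, y & E] i | i <- [:: (size E).+1, size E & m]] =
      [:: acc, y & e].
    rewrite map_cons map_cons map_reg_push ?below_push // map_reg_push //=.
    by rewrite !eqxx eqnSn.
  have step_le y acc : y <= (size w).+1 -> acc <= (size w).+1 ->
    step y acc <= (size w).+1.
    by move=> ly la; apply: eval_bounded; rewrite /= la ly.
  have loop y acc : y <= (size w).+1 -> acc <= (size w).+1 ->
    runs (While (size E).+3 nonempty 
        (Seq (Pop (size E).+3) (Seq c2 (drop_second (size E).+1))))
      (layout w [::] o [:: acc, y & E])
      (layout w [::] o [:: foldr step acc (iota 0 y), 0 & E])
      (y * b.+1).+1.
    elim: y acc => [|y IH] acc ly la.
      by apply: runs_whileF; rewrite /= eqnSn eqxx.
    have ly' := ltnW ly.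
    have bE' : bounded w [:: acc, y & E] by rewrite /= la ly'.
    have := hc2 w o [:: acc, y & E] erefl bE'; rewrite eqm => h2.
    (* [foldr] treats the last element first, as does a counter running down. *)
    have -> : foldr step acc (iota 0 y.+1) = foldr step (step y acc) (iota 0 y).
      by rewrite -addn1 iotaD foldr_cat.
    apply: runs_le (runs_whileT _ (runs_seq (runs_eq (runs_pop _ _) _)
      (runs_seq h2 (drop_second_runs _ _ _ (y :: E) _ _)))
      (IH (step y acc) ly' (step_le _ _ ly' la))) _.
    + by rewrite /= eqnSn eqxx.
    + by rewrite /= eqnSn eqxx; layout_tac.
    have := step_le y acc ly' la; rewrite -/(step y acc) /b; move: la ly.
    by set k := size w; nia.
  have fin : foldr step 0 (iota 0 (eval w e t)) <= (size w).+1.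
    apply: foldr_bounded => y acc ly la; apply: step_le => //.
    exact: leq_trans (ltnW ly) le.
  have eq0 : layout w [::] o (eval w e t :: E)
    = layout w [::] o [:: 0, eval w e t & E] by rewrite layout0.
  rewrite eq0 in h1.
  apply: runs_le (runs_seq h1 (runs_seq (loop _ _ le (leq0n _))
    (drop_second_runs _ _ _ _ _ _))) _.
  rewrite /b; move: fin le; set k := size w; nia.
Qed.

(** * Programs with output *)

(** Output is only written, never read back, so its length is free of the cap on values. *)
Inductive prog :=
| Emit of symbol
| Cat of prog & prog
| Cond of term & prog
| For of term & prog.

Fixpoint emitted w (e : seq nat) p : word :=
  match p with
  | Emit a => [:: a]
  | Cat p q => emitted w e p ++ emitted w e q
  | Cond t p => if eval w e t != 0 then emitted w e p else [::]
  | For t p => flatten [seq emitted w (y :: e) p | y <- iota 0 (eval w e t)]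
  end.

(* The output stack grows towards its first symbol, so commands run in the
   order opposite to that of the symbols they emit. *)
Lemma prog_computable p d m : all (fun j => j < d) m ->
  exists c f, polynomial f /\ forall w o E, size E = d -> bounded w E ->
    runs c (layout w [::] o E)
      (layout w [::] (emitted w (map (reg E) m) p ++ o) E) (f (size w)).
Proof.
elim: p d m => [a|p IHp q IHq|t p IHp|t p IHp] d m hm.
- exists (Push 1 a), (fun _ => 2); split; first by poly_tac.
  by move=> w o E szE bE; apply: runs_eq (runs_push _ _ _) _; layout_tac.
- have [c1 [f1 [hf1 hc1]]] := IHp d m hm.
  have [c2 [f2 [hf2 hc2]]] := IHq d m hm.
  exists (Seq c2 c1), (fun n => f2 n + f1 n); split; first by poly_tac.
  move=> w o E szE bE; rewrite /= -catA.
  by apply: runs_seq (hc2 _ _ _ szE bE) (hc1 _ _ _ szE bE).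
- have [c1 [f1 [hf1 hc1]]] := term_computable t hm.
  have [c2 [f2 [hf2 hc2]]] := IHp d m hm.
  exists (Seq c1 (If d.+3 nonempty (Seq (clear d.+3) c2) (Pop d.+3))).
  exists (fun n => f1 n + ((2 * n.+1).+1 + f2 n + 1).+1); split; first by poly_tac.
  move=> w o E szE bE; have h1 := hc1 w o E szE bE.
  have h2 := hc2 w o E szE bE; subst d.
  set e := map (reg E) m in h1 h2 *.
  have := eval_bounded t (map_reg_bounded m bE); rewrite -/e => le.
  apply: runs_seq h1 _; apply: runs_if; rewrite /= eqxx.
  case: (eval w e t) le => [|k] le /=.
    rewrite layout0; apply: (@runs_le _ _ _ 1); last by rewrite addn1.
    by apply: runs_eq (runs_pop _ _) _; rewrite /= reg_ge //; layout_tac.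
  by apply: runs_le (runs_seq (clear_top _ _ _ _ _) h2) _; lia.
- have [c1 [f1 [hf1 hc1]]] := term_computable t hm.
  have [|c2 [f2 [hf2 hc2]]] := IHp d.+1 (d :: m);
    first by rewrite /= leqnn below_push.
  exists (Seq c1 (While d.+3 nonempty (Seq (Pop d.+3) c2))).
  exists (fun n => f1 n + (n.+1 * (1 + f2 n).+1).+1); split; first by poly_tac.
  move=> w o E szE bE; have h1 := hc1 w o E szE bE; subst d.
  set e := map (reg E) m in h1 *.
  have le := eval_bounded t (map_reg_bounded m bE); rewrite -/e in le.
  rewrite /=; set F := fun y => emitted w (y :: e) p.
  have loop y o1 : y <= (size w).+1 ->
    runs (While (size E).+3 nonempty (Seq (Pop (size E).+3) c2))
      (layout w [::] o1 (y :: E))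
      (layout w [::] (flatten (map F (iota 0 y)) ++ o1) E)
      (y * (1 + f2 (size w)).+1).+1.
    elim: y o1 => [|y IH] o1 ly.
      by rewrite layout0; apply: runs_whileF; rewrite /= reg_ge.
    have bE' : bounded w (y :: E) by rewrite /= ltnW.
    have := hc2 w o1 (y :: E) erefl bE'.
    rewrite map_cons map_reg_push // [reg _ _]/= eqxx -/e -/(F y) => h2.
    have -> : flatten (map F (iota 0 y.+1)) ++ o1 =
        flatten (map F (iota 0 y)) ++ (F y ++ o1).
      by rewrite -addn1 iotaD map_cat flatten_cat /= cats0 catA.
    apply: runs_le (runs_whileT _ (runs_seq (runs_eq (runs_pop _ _) _) h2)
      (IH (F y ++ o1) (ltnW ly))) _.
    + by rewrite /= eqxx.
    + by rewrite /= eqxx; layout_tac.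
    + by rewrite mulSn; lia.
  apply: runs_le (runs_seq h1 (loop _ _ le)) _.
  by rewrite leq_add2l ltnS leq_mul2r le orbT.
Qed.

Lemma prog_polytime p : exists (M : machine symbol) (P : {poly nat}),
  forall w, computes_within M P.[size w]%R w (emitted w [::] p).
Proof.
have [|c [f [[P hP] hc]]] := @prog_computable p 0 [::]; first by [].
have [w|M hM] := @com_machine_computes c P (fun w => emitted w [::] p).
  have [n ex le] := hc w [::] [::] erefl isT.
  exists (layout w [::] (emitted w [::] p ++ [::]) [::]), n.
  split; [|by rewrite -hP|by rewrite /= cats0].
  have -> // : input_store w = layout w [::] [::] [::].
  by apply: functional_extensionality => -[|[|[|r]]].
by exists M, P.
Qed.

(** * The algorithm *)

Definition next_row r a := if a == Semicolon then r.+1 else r.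
Definition next_col c a :=
  if a == Semicolon then 0 else if a == Comma then c.+1 else c.

(** The row counts the semicolons before position [y], the column the commas since the latest of
    them. *)
Definition row w y := foldl next_row 0 (take y w).
Definition col w y := foldl next_col 0 (take y w).

(** The same coordinates by recursion on the word, for inductions over encodings. *)
Fixpoint tagged r c w : seq (nat * nat * symbol) :=
  if w is a :: w' then (r, c, a) :: tagged (next_row r a) (next_col c a) w'
  else [::].

Definition field_from r c w t := [seq x.2 | x <- tagged r c w & x.1 == t].

(* A separator belongs to the entry that it ends, so that copying a field copies
   its comma. *)
Definition field w r c := field_from 0 0 w (r, c).

Lemma taggedE r c w : tagged r c w =
  [seq (foldl next_row r (take y w), foldl next_col c (take y w), nth Semicolon w y)
     | y <- iota 0 (size w)].
Proof.
elim: w r c => //= a w IH r c; congr cons.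
by rewrite IH (iotaDl 1 0) -map_comp.
Qed.

Lemma tagged0E w : tagged 0 0 w =
  [seq (row w y, col w y, nth Semicolon w y) | y <- iota 0 (size w)].
Proof. exact: taggedE. Qed.

(** Horner's scheme: digits come least significant first, so [foldr] starts at the most significant
    one. *)
Definition num_step a acc :=
  match a with Bit true => acc.*2.+1 | Bit false => acc.*2 | _ => acc end.

Definition num (w : word) := foldr num_step 0 w.

(* Points are numbered from 1, so that 0 signals a missing entry; the cap
   makes the definition agree with the terms on malformed inputs. *)
Definition value w r c := minn (size w).+1 (num (field w r c)).

(** Smaller points override larger ones, so this is the least witness, with default 0. *)
Definition first (P : pred nat) b :=
  foldr (fun p acc => if P p then p else acc) 0 (iota 0 b).

Section Search.
Variable w : word.
Let b := (size w).+1.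

(* For a generator [a] in row [r], [loc r c] is the least [p] with
   [a (a p) = a c], or 0 if there is none.  In the latter case [good r] fails,
   since it requires [a (a 0) = a c]. *)
Definition loc r c := first (fun p =>
  (value w r p != 0) && (value w r (value w r p - 1) == value w r c)) b.

Definition ell r c := value w r (loc r c).

(** The candidate retraction fixes every generator from the left. Since the ranges exceed the
    tables, the tests [!= 0] single out actual entries. *)
Definition good r := (value w r 0 != 0) &&
  ~~ has (fun j => has (fun q =>
    (value w j q != 0) && (value w j (ell r q - 1) != value w j q)) (iota 0 b))
      (iota 0 b).

Definition same r r' :=
  ~~ has (fun q => (value w r q != 0) && (ell r q != ell r' q)) (iota 0 b).

(* Of equal solutions only the last one is listed, as in [undup]. *)
Definition selected r :=
  good r && ~~ has (fun r' => [&& r < r', good r' & same r r']) (iota 0 b).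

(** Every entry of a retraction of [a] is an entry of [a], so its numeral is copied from the
    input. *)
Definition listing := flatten [seq (if selected r then
    flatten [seq (if value w r q != 0 then field w r (loc r q) else [::])
               | q <- iota 0 b] ++ [:: Semicolon] else [::]) | r <- iota 0 b].

(** * Terms for the search *)

Definition holds e t := eval w e t != 0.

Definition tZero := Sub One One.
Definition tAnd t u := Ite t u tZero.
Definition tNot t := Ite t tZero One.
Definition tEq t u := Ite (Sub t u) tZero (tNot (Sub u t)).
Definition tLt t u := Sub u t.
(* [b - ((b - t) - u)] is the sum capped at [b]. *)
Definition tAdd t u := Sub Len (Sub (Sub Len t) u).
Definition tEx t := Fold Len (Ite t One (Var 0)).
Definition tFirst t := Fold Len (Ite t (Var 1) (Var 0)).
(** In [t], [Var 0] is the position read, recovered from the falling counter, and [Var 1] the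
    accumulator. *)
Definition tScan i t :=
  Fold (Var i) (Let (Sub (Sub (Var i.+2) (Var 1)) One) t).
Definition tRow i :=
  tScan i (Ite (Sym Semicolon (Var 0)) (tAdd (Var 1) One) (Var 1)).
Definition tCol i :=
  tScan i (Ite (Sym Semicolon (Var 0)) tZero
            (Ite (Sym Comma (Var 0)) (tAdd (Var 1) One) (Var 1))).
Definition tAt i r c := tAnd (tEq (tRow i) (Var r)) (tEq (tCol i) (Var c)).
Definition tValue r c :=
  Fold Len (Ite (tAt 1 r.+2 c.+2)
    (Ite (Sym (Bit true) (Var 1)) (tAdd (tAdd (Var 0) (Var 0)) One)
      (Ite (Sym (Bit false) (Var 1)) (tAdd (Var 0) (Var 0)) (Var 0)))
    (Var 0)).
(** Values count points from 1 and columns from 0, hence the subtraction. *)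
Definition tApply r t := Let (Sub t One) (tValue r.+1 0).
Definition tLoc r c := tFirst (tAnd (tValue r.+2 1)
  (tEq (tApply r.+2 (tValue r.+2 1)) (tValue r.+2 c.+2))).
Definition tEll r c := Let (tLoc r c) (tValue r.+1 0).
Definition tGood r := tAnd (Let tZero (tValue r.+1 0))
  (tNot (tEx (tEx (tAnd (tValue 3 1)
    (tNot (tEq (tApply 3 (tEll r.+4 1)) (tValue 3 1))))))).
Definition tSame r r' := tNot (tEx (tAnd (tValue r.+2 1)
  (tNot (tEq (tEll r.+2 1) (tEll r'.+2 1))))).
Definition tSelected r := tAnd (tGood r)
  (tNot (tEx (tAnd (tLt (Var r.+2) (Var 1)) (tAnd (tGood 1) (tSame r.+2 1))))).

(** * Correctness of the terms *)

Lemma eval_Var e i : eval w e (Var i) = nth 0 e i. Proof. by []. Qed.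
Lemma eval_Sub e t u : eval w e (Sub t u) = eval w e t - eval w e u.
Proof. by []. Qed.
Lemma eval_Let e t u : eval w e (Let t u) = eval w (eval w e t :: e) u.
Proof. by []. Qed.
Lemma eval_Ite e t u v :
  eval w e (Ite t u v) = if holds e t then eval w e u else eval w e v.
Proof. by []. Qed.
Lemma eval_Zero e : eval w e tZero = 0. Proof. by []. Qed.
Lemma eval_Add e t u : eval w e (tAdd t u) = minn b (eval w e t + eval w e u).
Proof. by rewrite /tAdd !eval_Sub /= -/b minnE; lia. Qed.

Lemma holds_And e t u : holds e (tAnd t u) = holds e t && holds e u.
Proof. by rewrite /holds /= -/(holds e t); case: ifP. Qed.
Lemma holds_Not e t : holds e (tNot t) = ~~ holds e t.
Proof. by rewrite /holds /= -/(holds e t); case: ifP. Qed.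
Lemma holds_Eq e t u : holds e (tEq t u) = (eval w e t == eval w e u).
Proof.
rewrite /tEq {1}/holds eval_Ite eval_Zero (fun_if (fun v => v != 0)).
rewrite -/(holds e (tNot _)) holds_Not /holds !eval_Sub.
by case: ifP; case: eqP; lia.
Qed.
Lemma holds_Lt e t u : holds e (tLt t u) = (eval w e t < eval w e u).
Proof. by rewrite /holds eval_Sub subn_eq0 -ltnNge. Qed.
Lemma holds_Sym e a t : holds e (Sym a t) = (ohead (drop (eval w e t) w) == Some a).
Proof. by rewrite /holds /= eqb0 negbK. Qed.

Lemma holds_Ex e t (P : pred nat) :
  (forall y acc, y < b -> holds [:: acc, y & e] t = P y) ->
  holds e (tEx t) = has P (iota 0 b).
Proof.
move=> hP; rewrite /holds (_ : eval w e (tEx t) =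
  foldr (fun y acc => if holds [:: acc, y & e] t then 1 else acc) 0 (iota 0 b)) //.
have : all (fun y => y < b) (iota 0 b) by apply/allP => y; rewrite mem_iota.
elim: (iota 0 b) => //= y l IH /andP[ly /IH {}IH].
by rewrite hP //; case: (P y).
Qed.

Lemma eval_First e t (P : pred nat) :
  (forall y acc, y < b -> holds [:: acc, y & e] t = P y) ->
  eval w e (tFirst t) = first P b.
Proof.
move=> hP; rewrite /first (_ : eval w e (tFirst t) =
  foldr (fun y acc => if holds [:: acc, y & e] t then y else acc) 0 (iota 0 b)) //.
have : all (fun y => y < b) (iota 0 b) by apply/allP => y; rewrite mem_iota.
elim: (iota 0 b) => //= y l IH /andP[ly /IH {}IH].
by rewrite hP // IH.
Qed.

Lemma ohead_drop y : y < size w -> ohead (drop y w) = Some (nth Semicolon w y).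
Proof. by move=> ly; rewrite (drop_nth Semicolon). Qed.

(** A count never exceeds the number of symbols read, so capped addition is exact in scans. *)
Lemma foldl_step_le (g : nat -> symbol -> nat) s :
  (forall acc a, g acc a <= acc.+1) -> foldl g 0 s <= size s.
Proof.
move=> hg; elim/last_ind: s => //= s a IH.
by rewrite foldl_rcons size_rcons; apply: leq_trans (hg _ _) _.
Qed.

(* [Fold] counts down from [y], so the scanned position is [y - z - 1]. *)
Lemma scanE (F : nat -> nat -> nat -> nat) g y :
  (forall acc a, g acc a <= acc.+1) ->
  (forall z p acc, p < size w -> acc <= p ->
    F z p acc = g acc (nth Semicolon w p)) ->
  y <= size w ->
  foldr (fun z acc => F z (y - z - 1) acc) 0 (iota 0 y) = foldl g 0 (take y w).
Proof.
move=> hg; elim: y F => [|y IH] F hF ly; first by rewrite take0.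
(* The outermost step, with counter 0, reads the last position; the others have their counters
   shifted by one, which is why [F] is generalized. *)
rewrite (take_nth Semicolon) // foldl_rcons -(IH (fun z => F z.+1)) => [||//];
  last exact: ltnW.
  rewrite [iota 0 y.+1]/= (iotaDl 1 0) /= foldr_map subn0 subSS subn0 hF //.
  have -> : foldr (fun z acc => F (1 + z) (y.+1 - (1 + z) - 1) acc) 0 (iota 0 y) =
      foldl g 0 (take y w).
    rewrite -(IH (fun z => F z.+1)) //; last exact: ltnW.
    by move=> z p acc; apply: hF.
  by apply: leq_trans (foldl_step_le _ hg) _; rewrite size_take_min geq_minl.
by move=> z p acc; apply: hF.
Qed.

Lemma eval_Scan e i t g : (forall acc a, g acc a <= acc.+1) ->
  (forall z p acc, p < size w -> acc <= p ->
    eval w [:: p, acc, z & e] t = g acc (nth Semicolon w p)) ->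
  nth 0 e i <= size w ->
  eval w e (tScan i t) = foldl g 0 (take (nth 0 e i) w).
Proof.
move=> hg ht ly.
by rewrite -(scanE (F := fun z p acc => eval w [:: p, acc, z & e] t)).
Qed.

Lemma next_row_le acc a : next_row acc a <= acc.+1.
Proof. by rewrite /next_row; case: ifP. Qed.

Lemma next_col_le acc a : next_col acc a <= acc.+1.
Proof. by rewrite /next_col; do 2?case: ifP. Qed.

Lemma eval_Row e i : nth 0 e i <= size w -> eval w e (tRow i) = row w (nth 0 e i).
Proof.
apply: eval_Scan; first exact: next_row_le.
move=> z p acc lp la; rewrite eval_Ite holds_Sym eval_Add /= ohead_drop //.
by rewrite /next_row (inj_eq Some_inj); case: eqP => // _; rewrite /b; lia.
Qed.

Lemma eval_Col e i : nth 0 e i <= size w -> eval w e (tCol i) = col w (nth 0 e i).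
Proof.
apply: eval_Scan; first exact: next_col_le.
move=> z p acc lp la; rewrite !eval_Ite !holds_Sym eval_Add eval_Zero /=
  ohead_drop //.
by rewrite /next_col !(inj_eq Some_inj); do 2!case: eqP => // _; rewrite /b; lia.
Qed.

Lemma holds_At e i r c : nth 0 e i <= size w ->
  holds e (tAt i r c) =
  ((row w (nth 0 e i), col w (nth 0 e i)) == (nth 0 e r, nth 0 e c)).
Proof. by move=> le; rewrite holds_And !holds_Eq eval_Row // eval_Col. Qed.

Lemma eval_Value e r c : eval w e (tValue r c) = value w (nth 0 e r) (nth 0 e c).
Proof.
rewrite /value /field /field_from tagged0E /tValue.
set R := nth 0 e r; set C := nth 0 e c; set body := Ite _ _ _.
rewrite (_ : eval w e _ =
  foldr (fun y acc => eval w [:: acc, y & e] body) 0 (iota 0 b)) //.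
(* [Len] makes the loop visit one position past the input, which contributes 0. *)
rewrite (_ : iota 0 b = rcons (iota 0 (size w)) (size w)); last first.
  by rewrite -cats1 /b -addn1 iotaD.
(* Capping after each digit agrees with capping once at the end. *)
have body_in y x : y < size w -> eval w [:: minn b x, y & e] body =
    minn b (if (row w y, col w y) == (R, C) then num_step (nth Semicolon w y)
      x else x).
  move=> ly; rewrite /body !eval_Ite holds_At; last exact: ltnW.
  rewrite !holds_Sym !eval_Add !eval_Var /=.
  rewrite ohead_drop // -/R -/C !(inj_eq Some_inj); case: eqP => // _.
  by case: (nth _ _ _) => [[]||] //=; rewrite -addnn; lia.
have body_out : eval w [:: 0, size w & e] body = 0.
  rewrite /body !eval_Ite !holds_Sym !eval_Add /= drop_size.
  by case: (holds _ _).
rewrite foldr_rcons body_out -/b; clearbody body; clear body_out.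
have : all (fun y => y < size w) (iota 0 (size w)).
  by apply/allP => y; rewrite mem_iota.
elim: (iota 0 (size w)) => [|y l IH]; first by rewrite minn0.
move=> /= /andP[ly /IH ->]; rewrite body_in //.
by rewrite [((_, _).1 == _)]/=; case: ifP.
Qed.

Lemma eval_Apply e r t :
  eval w e (tApply r t) = value w (nth 0 e r) (eval w e t - 1).
Proof. by rewrite /tApply eval_Let eval_Value eval_Sub. Qed.

Lemma holds_Value e r c :
  holds e (tValue r c) = (value w (nth 0 e r) (nth 0 e c) != 0).
Proof. by rewrite /holds eval_Value. Qed.

Lemma eval_Loc e r c : eval w e (tLoc r c) = loc (nth 0 e r) (nth 0 e c).
Proof.
apply: eval_First => y acc ly.
by rewrite holds_And holds_Value holds_Eq eval_Apply !eval_Value.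
Qed.

Lemma eval_Ell e r c : eval w e (tEll r c) = ell (nth 0 e r) (nth 0 e c).
Proof. by rewrite /tEll eval_Let eval_Loc eval_Value. Qed.

Lemma holds_Good e r : holds e (tGood r) = good (nth 0 e r).
Proof.
rewrite holds_And holds_Not /good; congr (_ && ~~ _).
  by rewrite /holds eval_Let eval_Value eval_Zero.
apply: holds_Ex => j acc1 _; apply: holds_Ex => q acc2 _.
by rewrite holds_And holds_Not holds_Eq holds_Value eval_Apply eval_Ell !eval_Value.
Qed.

Lemma holds_Same e r r' : holds e (tSame r r') = same (nth 0 e r) (nth 0 e r').
Proof.
rewrite holds_Not; congr (~~ _); apply: holds_Ex => q acc _.
by rewrite holds_And holds_Not holds_Eq holds_Value !eval_Ell.
Qed.

Lemma holds_Selected e r : holds e (tSelected r) = selected (nth 0 e r).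
Proof.
rewrite holds_And holds_Not holds_Good; congr (_ && ~~ _).
by apply: holds_Ex => r' acc _;
  rewrite holds_And holds_Lt holds_And holds_Good holds_Same.
Qed.

(** * Printing the listing *)

Definition emit_symbol i :=
  let c a := Cond (Sym a (Var i)) (Emit a) in
  Cat (c (Bit true)) (Cat (c (Bit false)) (Cat (c Comma) (c Semicolon))).

Lemma emitted_Cond e t p :
  emitted w e (Cond t p) = if holds e t then emitted w e p else [::].
Proof. by []. Qed.

Lemma emitted_symbol e i :
  emitted w e (emit_symbol i) = seq_of_opt (ohead (drop (nth 0 e i) w)).
Proof.
rewrite [LHS]/= -!/(holds e (Sym _ (Var i))) !holds_Sym /=.
by case: ohead => [[[]||]|].
Qed.

Definition pListing :=
  For Len (Cond (tSelected 0)
    (Cat (For Len (Cond (tValue 1 0)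
            (For Len (Cond (Let (tLoc 2 1) (tAt 1 3 0)) (emit_symbol 0)))))
         (Emit Semicolon))).

Lemma emitted_For e t p : emitted w e (For t p) =
  flatten [seq emitted w (y :: e) p | y <- iota 0 (eval w e t)].
Proof. by []. Qed.

Lemma emitted_Cat e p q : emitted w e (Cat p q) = emitted w e p ++ emitted w e q.
Proof. by []. Qed.

Lemma flatten_field r c :
  flatten [seq (if (row w y, col w y) == (r, c)
                then seq_of_opt (ohead (drop y w)) else [::])
             | y <- iota 0 b] = field w r c.
Proof.
rewrite /b -addn1 iotaD map_cat flatten_cat /= drop_size /= if_same !cats0.
rewrite /field /field_from tagged0E.
have : all (fun y => y < size w) (iota 0 (size w)).
  by apply/allP => y; rewrite mem_iota.
elim: (iota 0 (size w)) => //= y l IH /andP[ly /IH ->].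
by rewrite ohead_drop //; case: ifP.
Qed.

Lemma emitted_listing : emitted w [::] pListing = listing.
Proof.
rewrite emitted_For -/b; congr flatten; apply: eq_map => r.
rewrite emitted_Cond holds_Selected emitted_Cat.
rewrite emitted_For -/b; congr (if _ then flatten _ ++ _ else _);
  apply: eq_map => q.
rewrite emitted_Cond holds_Value emitted_For -flatten_field.
congr (if _ then flatten _ else _); apply/eq_in_map => y; rewrite mem_iota => ly.
rewrite emitted_Cond emitted_symbol /holds eval_Let -/(holds _ _) eval_Loc.
by rewrite holds_At.
Qed.
End Search.

(** * Reading the encoded instance *)

Definition encode_bits (bs : seq bool) : word := rcons [seq Bit x | x <- bs] Comma.

Lemma field_from_cons r c a w t : field_from r c (a :: w) t =
  (if (r, c) == t then [:: a] else [::]) ++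
  field_from (next_row r a) (next_col c a) w t.
Proof. by rewrite /field_from /=; case: ifP. Qed.

Lemma field_from_bits r c bs w t :
  field_from r c (encode_bits bs ++ w) t =
  (if (r, c) == t then encode_bits bs else [::]) ++ field_from r c.+1 w t.
Proof.
elim: bs => [|x bs IH]; first by rewrite field_from_cons.
by rewrite field_from_cons IH; case: ifP.
Qed.

(** Coordinates increase lexicographically along the word, so a field once passed does not
    return. *)
Lemma field_from_past r c w r' c' :
  (r' < r) || (r' == r) && (c' < c) -> field_from r c w (r', c') = [::].
Proof.
elim: w r c => // a w IH r c lt; rewrite field_from_cons xpair_eqE.
case: andP => [[/eqP e1 /eqP e2]|_]; first by move: lt; rewrite e1 e2; lia.
by apply: IH; move: lt; rewrite /next_row /next_col; do 2?case: ifP; lia.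
Qed.

Definition encode_table (vs : seq (seq bool)) : word :=
  rcons (flatten [seq encode_bits bs | bs <- vs]) Semicolon.

(** The closing semicolon has the column just after the last entry, whence the middle case. The
    hypothesis says that the field has not been passed. *)
Lemma field_from_table r c vs w r' c' : c <= c' \/ r != r' ->
  field_from r c (encode_table vs ++ w) (r', c') =
  if r' == r then
    if c' < c + size vs then encode_bits (nth [::] vs (c' - c))
    else if c' == c + size vs then [:: Semicolon] else [::]
  else field_from r.+1 0 w (r', c').
Proof.
rewrite /encode_table; elim: vs c => [|bs vs IH] c hc.
  rewrite /= field_from_cons xpair_eqE -[next_row _ _]/r.+1 -[next_col _ _]/0.
  rewrite addn0 eq_sym (eq_sym c); case: (altP (r' =P r)) hc => [->|_ _] //;
    rewrite eqxx => -[le|//].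
  by rewrite ltnNge le /= field_from_past ?ltnSn // cats0.
rewrite /= rcons_cat -catA field_from_bits xpair_eqE.
case: (altP (r' =P r)) hc => [e|ne _]; last first.
  by rewrite IH ?(negPf ne); [rewrite eq_sym (negPf ne) | right; rewrite eq_sym].
subst r'; rewrite eqxx => -[le|//].
case: (altP (c =P c')) => [->|ne] /=.
  by rewrite field_from_past ?ltnSn ?eqxx ?orbT // cats0 subnn /= addnS ltnS
    leq_addr.
rewrite IH; last by left; rewrite ltn_neqAle ne.
rewrite eqxx addSnnS.
have -> : c' - c = (c' - c.+1).+1 by lia.
by [].
Qed.

Lemma field_tables r0 vss r c : r0 <= r ->
  field_from r0 0 (flatten (map encode_table vss)) (r, c) =
  if r - r0 < size vss then
    let vs := nth [::] vss (r - r0) in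
    if c < size vs then encode_bits (nth [::] vs c)
    else if c == size vs then [:: Semicolon] else [::]
  else [::].
Proof.
elim: vss r0 => [|vs vss IH] r0 le; first by [].
rewrite /= field_from_table; last by left.
case: eqP => [->|ne]; first by rewrite subnn /= add0n subn0.
rewrite IH; last by lia.
have -> : r - r0 = (r - r0.+1).+1 by lia.
by rewrite ltnS.
Qed.

Lemma num_bits bs :
  num (encode_bits bs) = foldr (fun (x : bool) acc => x + acc.*2) 0 bs.
Proof.
rewrite /num /encode_bits -cats1 foldr_cat /=.
by elim: bs => //= -[] bs ->.
Qed.

Lemma num_bits_of_nat m : num (encode_bits (bits_of_nat m)) = m.
Proof.
rewrite num_bits -[RHS]bin_of_natK /bits_of_nat; case: bin_of_nat => //=.
by elim=> //= p ->; rewrite NatTrec.doubleE ?add0n ?add1n.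
Qed.

Section Instance.
Variable x : instance.
Let n := degree x.
Let k := ngens x.
Let w := encode_instance x.
Let b := (size w).+1.

Definition gen (r : 'I_k) : transf n := tnth (gens x) r.

Definition table (s : transf n) := [seq bits_of_nat (s q).+1 | q <- enum 'I_n].

Lemma encode_transfE (s : transf n) : encode_transf s = encode_table (table s).
Proof. by rewrite /encode_transf /encode_table /table -map_comp. Qed.

Lemma encode_instanceE : w = flatten (map encode_table (map table (gens x))).
Proof.
rewrite /w /encode_instance /encode_transfs -map_comp.
by congr flatten; apply: eq_map => s; apply: encode_transfE.
Qed.

Lemma size_table s : size (table s) = n.
Proof. by rewrite size_map size_enum_ord. Qed.

Lemma nth_table s (q : 'I_n) : nth [::] (table s) q = bits_of_nat (s q).+1.
Proof. by rewrite (nth_map q) ?size_enum_ord // nth_ord_enum. Qed.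

Lemma nth_tables (r : 'I_k) : nth [::] (map table (gens x)) r = table (gen r).
Proof. by rewrite (nth_map (gen r)) ?size_tuple // /gen -tnth_nth. Qed.

Lemma field_gen (r : 'I_k) (q : 'I_n) : field w r q = encode_point (gen r q).
Proof.
rewrite /field encode_instanceE field_tables // subn0 size_map size_tuple ltn_ord.
by rewrite /= nth_tables size_table ltn_ord nth_table.
Qed.

(** Each point costs at least a comma and each generator a semicolon; hence loops up to [b] reach
    all rows and columns. *)
Lemma leq_encode : k <= size w /\ n <= size w.
Proof.
have hs (s : transf n) : n < size (encode_transf s).
  rewrite encode_transfE size_rcons ltnS -[X in X <= _](size_table s).
  rewrite size_flatten /shape -map_comp sumnE big_map -sum1_size.
  by apply: leq_sum => v _; rewrite /= size_rcons.
rewrite /w /encode_instance /encode_transfs size_flatten /shape -map_comp sumnE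
  big_map.
split.
  rewrite -[X in X <= _](size_tuple (gens x)) -sum1_size.
  by apply: leq_sum => s _; apply: leq_ltn_trans (hs s).
have s0 : tnth (gens x) (Ordinal (ngens_gt0 x)) \in tval (gens x)
  by apply: mem_tnth.
rewrite (big_rem _ s0) /=; apply: leq_trans (leq_addr _ _); exact: ltnW (hs _).
Qed.

Lemma value_gen (r : 'I_k) (q : 'I_n) : value w r q = (gen r q).+1.
Proof.
rewrite /value field_gen num_bits_of_nat; apply/minn_idPr.
by rewrite ltnS; apply: leq_trans (ltn_ord _) (leqW (proj2 leq_encode)).
Qed.

(** Outside the tables a field is empty or a lone semicolon, of value 0. *)
Lemma value_out r q : (value w r q != 0) = (r < k) && (q < n).
Proof.
case: (ltnP r k) => [lr|gr]; last first.
  rewrite /value /field encode_instanceE field_tables // subn0 size_map size_tuple.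
  by rewrite ltnNge gr.
case: (ltnP q n) => [lq|gq]; first by rewrite (value_gen (Ordinal lr) (Ordinal lq)).
rewrite /value /field encode_instanceE field_tables // subn0 size_map size_tuple lr.
rewrite /= (nth_tables (Ordinal lr)) size_table ltnNge gq /=.
by case: ifP.
Qed.
End Instance.

(** * Left identities and retractions *)

Section Semigroup.
Variables (n : nat) (A : seq (transf n)).
Local Notation S := (subsemigroup_generated A).

Definition retraction_of (a e : transf n) :=
  forall q, exists2 p, e q = a p & a (a p) = a q.

Definition transf_iter (a : transf n) m : transf n := [ffun q => iter m a q].

(* A retraction shows that [a] maps its image onto itself; two powers of [a]
   coincide by the pigeonhole principle. *)
Lemma retraction_period a e : retraction_of a e ->
  exists m, forall q, iter m.+1 a (a q) = a q.
Proof.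
move=> ae.
(* By [a q = a (a p)], each image point has a preimage in the image; this is iterated. *)
have onto i q : exists y, a q = iter i a (a y).
  elim: i q => [|i IH] q; first by exists q.
  by have [p _ <-] := ae q; have [y ->] := IH p; exists y.
pose f (i : 'I_#|{: transf n}|.+1) := transf_iter a i.
have /injectivePn[i [j ne e_ij]] : ~~ injectiveb f.
  by apply/negP => /injectiveP /leq_card; rewrite card_ord ltnn.
wlog lt : i j ne e_ij / i < j.
  move=> H; case: (ltngtP i j) => lt; first exact: (H i j).
    by apply: (H j i) => //; rewrite eq_sym.
  by case/eqP: ne; apply: val_inj.
(* With [a q = a^i (a y)], applying [a^(j-i)] gives [a^j (a y) = a^i (a y)]. *)
exists (j - i).-1 => q; rewrite prednK ?subn_gt0 //.
have [y ->] := onto i q; rewrite -iterD subnK ?(ltnW lt) //.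
by have /ffunP/(_ (a y)) := e_ij; rewrite !ffunE.
Qed.

(** [e q = a p = a^(m+1) (a p) = a^m (a (a p)) = a^m (a q)]. *)
Lemma retraction_power a e m : retraction_of a e ->
  (forall q, iter m.+1 a (a q) = a q) -> e = transf_iter a m.+1.
Proof.
move=> ae per; apply/ffunP => q; rewrite ffunE.
have [p -> ap] := ae q.
by rewrite -per iterSr ap -iterSr.
Qed.

(** The period depends on [a] alone, so both are the same power of [a]. *)
Lemma retraction_uniq a e e' : retraction_of a e -> retraction_of a e' -> e = e'.
Proof.
move=> ae ae'; have [m per] := retraction_period ae.
by rewrite (retraction_power ae per) (retraction_power ae' per).
Qed.

Lemma retraction_generated a e : a \in A -> retraction_of a e -> S e.
Proof.
move=> aA ae; have [m /(retraction_power ae) ->] := retraction_period ae.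
elim: m => [|m IH].
  have -> : transf_iter a 1 = a by apply/ffunP => q; rewrite ffunE.
  exact: SG_gen.
have -> : transf_iter a m.+2 = (transf_iter a m.+1 * a)%g.
  by apply/ffunP => q; rewrite !ffunE.
by apply: SG_mul IH (SG_gen aA).
Qed.

(** [a] is the last factor of a product of generators equal to [s]. *)
Lemma generated_last s : S s -> exists2 a, a \in A & forall q, exists p, s q = a p.
Proof.
elim=> [a aA|s1 s2 _ _ _ [a aA h]]; first by exists a => // q; exists q.
by exists a => // q; have [p e] := h (s1 q); exists p; rewrite ffunE.
Qed.

(** By associativity only the first factor of a product matters. *)
Lemma left_identity_gens s : S s -> (forall a, a \in A -> (s * a)%g = a) ->
  left_identity S s.
Proof.
move=> Ss h; split=> // t; elim=> [a /h //|t1 t2 _ IH1 _ _].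
by rewrite mulgA IH1.
Qed.

(** If [s] ends in [a], then [s q = a p], and [s a = a] gives [a (a p) = a q]. *)
Lemma left_identity_retraction s : left_identity S s ->
  exists2 a, a \in A & retraction_of a s.
Proof.
move=> [/generated_last[a aA h] id_s]; exists a => // q.
have [p e] := h q; exists p => //.
by have /ffunP/(_ q) := id_s a (SG_gen aA); rewrite ffunE e.
Qed.
End Semigroup.

(** * Correctness of the algorithm *)

Lemma first_cases P b : first P b = 0 \/ P (first P b).
Proof.
by rewrite /first; elim: (iota 0 b) => [|p l IH] /=; [left | case: ifP; [right|]].
Qed.

Lemma first_has P b : has P (iota 0 b) -> P (first P b).
Proof. by rewrite /first; elim: (iota 0 b) => //= p l IH; case: ifP. Qed.

(** [undup] keeps the last of several equal elements, as does the test for a later equal index. *)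
Lemma flatten_undup (T : eqType) (f : nat -> T) (P : pred nat)
    (enc : T -> word) N m l :
  N = m + l ->
  flatten [seq (if P i && ~~ has (fun j => [&& i < j, P j & f i == f j]) (iota 0 N)
                then enc (f i) else [::]) | i <- iota m l] =
  flatten [seq enc t | t <- undup [seq f i | i <- iota m l & P i]].
Proof.
move=> ->; elim: l m => // l IH m; rewrite addnS -addSn; move/(_ m.+1): IH.
(* The inner range is hidden behind a variable, so that simplification unfolds only the outer
   one. *)
have [N' eN] : exists N', N' = m.+1 + l by eexists.
rewrite -eN => IH.
rewrite /= IH; case Pm: (P m) => //=.
suff -> : has (fun j => [&& m < j, P j & f m == f j]) (iota 0 N') =
    (f m \in [seq f i | i <- iota m.+1 l & P i]) by case: (_ \in _).
rewrite eN.
apply/hasP/mapP => [[j]|[j]].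
  rewrite mem_iota add0n => /= lj /and3P[mj Pj /eqP e].
  by exists j; rewrite // mem_filter Pj mem_iota mj.
rewrite mem_filter mem_iota => /and3P[Pj mj lj] ->.
by exists j; rewrite ?mem_iota ?add0n //= mj Pj eqxx.
Qed.

Section Correctness.
Variable x : instance.
Let n := degree x.
Let k := ngens x.
Let w := encode_instance x.
Let b := (size w).+1.
Local Notation S := (subsemigroup_generated (gens x)).

Definition retract (r : nat) : transf n :=
  [ffun q : 'I_n => insubd q (ell w r q).-1].

Lemma lt_degree_size q : q < n -> q < b.
Proof. by move/leq_trans; apply; apply: leqW (proj2 (leq_encode x)). Qed.

Lemma lt_ngens_size r : r < k -> r < b.
Proof. by move/leq_trans; apply; apply: leqW (proj1 (leq_encode x)). Qed.

(** Even a failed search returns a point, namely 0, because the degree is positive. *)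
Lemma loc_point (r : 'I_k) (q : 'I_n) : exists p : 'I_n, loc w r q = p /\
  ((exists p', gen r (gen r p') = gen r q) -> gen r (gen r p) = gen r q).
Proof.
have cand (p : 'I_n) :
    (value w r p != 0) && (value w r (value w r p - 1) == value w r q) =
    (gen r (gen r p) == gen r q).
  by rewrite !value_gen subn1 value_gen eqSS.
have lt : loc w r q < n.
  have [e|/andP[+ _]] := first_cases (fun p =>
      (value w r p != 0) && (value w r (value w r p - 1) == value w r q)) b.
    by rewrite /loc e; exact: degree_gt0.
  by rewrite value_out => /andP[].
exists (Ordinal lt); split=> // -[p' e]; apply/eqP; rewrite -cand.
apply: (@first_has (fun p => (value w r p != 0) &&
  (value w r (value w r p - 1) == value w r q))).
apply/hasP; exists (val p'); first by rewrite mem_iota lt_degree_size ?ltn_ord.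
by apply: etrans (cand p') _; rewrite e eqxx.
Qed.

Lemma ell_gen (r : 'I_k) (q : 'I_n) : ell w r q = (retract r q).+1.
Proof.
have [p [e _]] := loc_point r q.
rewrite ffunE /ell e value_gen /=.
by rewrite val_insubd ltn_ord.
Qed.

Lemma retract_gen (r : 'I_k) (q : 'I_n) :
  exists2 p : 'I_n, loc w r q = p & retract r q = gen r p.
Proof.
have [p [e _]] := loc_point r q; exists p => //.
by apply/val_inj/succn_inj; rewrite -ell_gen /ell e value_gen.
Qed.

Lemma goodE (r : 'I_k) : good w r = [forall j, (retract r * gen j)%g == gen j].
Proof.
rewrite /good (value_out x r 0) ltn_ord degree_gt0 !andTb.
apply/hasPn/forallP => [h j | h j _].
  apply/eqP/ffunP => q; rewrite ffunE.
  have jb : val j \in iota 0 b by rewrite mem_iota lt_ngens_size ?ltn_ord.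
  have qb : val q \in iota 0 b by rewrite mem_iota lt_degree_size ?ltn_ord.
  have /hasPn/(_ _ qb) := h _ jb.
  rewrite ell_gen subn1 !value_gen.
  by rewrite /= negbK eqSS => /eqP/val_inj.
apply/hasPn => q _; rewrite negb_and -implybE.
apply/implyP; rewrite value_out => /andP[lj lq].
have /eqP/ffunP/(_ (Ordinal lq)) := h (Ordinal lj); rewrite ffunE => e.
rewrite negbK (ell_gen r (Ordinal lq)) subn1.
by rewrite (value_gen (Ordinal lj)) (value_gen (Ordinal lj) (Ordinal lq)) e.
Qed.

Lemma good_lt r : good w r -> r < k.
Proof. by rewrite /good value_out => /andP[/andP[]]. Qed.

Lemma sameE (r r' : 'I_k) : same w r r' = (retract r == retract r').
Proof.
apply/hasPn/eqP => [h|e q _].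
  apply/ffunP => q; have := h (val q);
    rewrite mem_iota lt_degree_size ?ltn_ord // => /(_ isT).
  by rewrite value_gen !ell_gen /= negbK eqSS => /eqP/val_inj.
rewrite value_out ltn_ord /=; case: ltnP => //= lq.
by rewrite (ell_gen r (Ordinal lq)) (ell_gen r' (Ordinal lq)) e negbK.
Qed.

Definition solution := undup [seq retract r | r <- iota 0 b & good w r].

Lemma encode_retract (r : 'I_k) :
  flatten [seq (if value w r q != 0 then field w r (loc w r q) else [::])
    | q <- iota 0 b]
    ++ [:: Semicolon] = encode_transf (retract r).
Proof.
rewrite /encode_transf cats1; congr rcons.
(* Columns from [n] on hold no value and print nothing. *)
have -> : b = n + (b - n) by have [_] := leq_encode x; rewrite /b -/w -/n; lia.
rewrite iotaD map_cat flatten_cat add0n.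
have -> : flatten [seq (if value w r q != 0 then field w r (loc w r q) else [::])
    | q <- iota n (b - n)] = [::].
  have : all (leq n) (iota n (b - n)).
    by apply/allP => q; rewrite mem_iota => /andP[].
  elim: (iota _ _) => //= q l IH /andP[le /IH->].
  by rewrite value_out ltn_ord ltnNge le.
rewrite cats0 -val_enum_ord -map_comp; congr flatten; apply: eq_map => q /=.
by rewrite value_gen; have [p -> ->] := retract_gen r q; rewrite field_gen.
Qed.

Lemma listingE : listing w = encode_solution solution.
Proof.
rewrite /encode_solution /encode_transfs /solution.
rewrite -(flatten_undup _ _ _ (erefl b : b = 0 + b)).
congr flatten; apply: eq_map => r.
rewrite /selected; case gr: (good w r) => //=.
have lr := good_lt gr; rewrite (encode_retract (Ordinal lr)).
congr (if ~~ _ then _ else _); apply: eq_has => r'.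
case gr': (good w r') => /=; last by rewrite !andbF.
by rewrite (sameE (Ordinal lr) (Ordinal (good_lt gr'))).
Qed.

Lemma mem_solution s : s \in solution <-> left_identity S s.
Proof.
have genP a : a \in tval (gens x) -> exists r : 'I_k, a = gen r.
  by move=> /tnthP.
rewrite mem_undup; split.
  case/mapP => r; rewrite mem_filter => /andP[gr _] ->.
  move: gr; move/[dup]/good_lt => lr; pose R := Ordinal lr.
  rewrite -[r]/(val R) goodE => /forallP gR.
  apply: left_identity_gens => [|a /genP[j ->]]; last exact/eqP.
  apply: (retraction_generated (a := gen R)); first exact: mem_tnth.
  move=> q; have [p _ e] := retract_gen R q; exists p => //.
  (* The test of [good] against the generator of the same row gives [a (a p) = a q]. *)
  by have /eqP/ffunP/(_ q) := gR R; rewrite ffunE e.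
move=> /[dup] -[_ ids] /left_identity_retraction[a /genP[r ->]] sr.
(* The retraction [s] supplies witnesses for the search at every point, so [retract r] is a
   retraction too, and uniqueness applies. *)
have e : s = retract r.
  apply: (retraction_uniq sr) => q.
  have [p [locp hp]] := loc_point r q; have [p1 locp1 ->] := retract_gen r q.
  exists p1 => //; have <- : p = p1 by apply: val_inj; rewrite /= -locp.
  by apply: hp; have [p' _ ?] := sr q; exists p'.
apply/mapP; exists (val r) => //.
rewrite mem_filter mem_iota goodE; apply/andP; split;
  last by rewrite add0n lt_ngens_size ?ltn_ord.
by apply/forallP => j; rewrite -e ids //; apply: SG_gen; apply: mem_tnth.
Qed.
End Correctness.

Theorem theorem6p2 :
  polytime_computable encode_instance encode_solution LeftIdentities.
Proof.
have [M [p hM]] := prog_polytime pListing.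
exists M, p => x; exists (solution x).
  by split; [apply: undup_uniq | apply: mem_solution].
by rewrite -listingE -emitted_listing.
Qed.
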